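(* Let $\Gamma$ be a finite $(G,s)$-geodesic-transitive digraph for some integer $s\geq 2$, where $G\leq\mathrm{Aut}(\Gamma)$, and let $N$ be a nontrivial normal subgroup of $G$ which acts regularly on $V(\Gamma)$. Then $\Gamma$ is a circuit. In particular, every $(G,s)$-geodesic-transitive $G$-normal Cayley digraph with $s\geq 2$ is a circuit.
   Context: A digraph $\Gamma$ consists of a finite vertex set $V(\Gamma)$ with an antisymmetric irreflexive relation $\rightarrow$; an arc is an ordered pair $(u,v)$ with $u\rightarrow v$. The distance $d_\Gamma(u,v)$ is the length of a shortest directed path from $u$ to $v$. An $s$-arc is a sequence $(v_0,\dots,v_s)$ with $v_i\rightarrow v_{i+1}$ for all $i$; it is an $s$-geodesic if $d_\Gamma(v_0,v_s)=s$. $\Gamma$ is $(G,s)$-geodesic-transitive if $G$ is transitive on the set of $i$-geodesics for each $i\leq s$. A circuit is a directed cycle $w_0\rightarrow w_1\rightarrow\cdots\rightarrow w_{r-1}\rightarrow w_0$ on distinct vertices, $r\geq 3$. A group acts regularly if it is transitive with trivial point stabilizers. For a group $H$ and $S\subseteq H\setminus\{1\}$ with $S\cap S^{-1}=\emptyset$, the Cayley digraph $\mathrm{Cay}(H,S)$ has vertex set $H$ and arcs $(h,xh)$ for $h\in H$, $x\in S$; with $H$ acting by right multiplication, $\mathrm{Cay}(H,S)$ is $G$-normal if $H\leq G\leq\mathrm{Aut}(\mathrm{Cay}(H,S))$ and $H\trianglelefteq G$.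
   Formalization: The digraph is additionally assumed connected (as an undirected graph) in both parts, and the group H of the Cayley digraph nontrivial; otherwise two disjoint directed 3-cycles, Cay(Z_6,{2}) with G=N=Z_6, or the one-vertex digraph would be counterexamples. *)

(* Defs.v *)
From mathcomp Require Import all_boot all_fingroup.

Set Implicit Arguments.
Unset Strict Implicit.
Unset Printing Implicit Defensive.

Local Open Scope group_scope.

(* Digraphs are given by their arc relation [e] on a finType of vertices. *)

Definition is_digraph (V : finType) (e : rel V) : Prop :=
  irreflexive e /\ antisymmetric e.

(* Connectedness of the underlying undirected graph (weaker than strong
   connectedness). *)
Definition connected (V : finType) (e : rel V) : Prop :=
  forall u v : V, connect [rel x y | e x y || e y x] u v.

Definition digraph_aut (V : finType) (e : rel V) : {set {perm V}} :=
  [set g : {perm V} | [forall u, forall v, e (g u) (g v) == e u v]].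

(* [u :: p] is a directed path from [u] to [last u p], of length [size p].
   The distance is a partial function of (u, v), hence a relation here:
   no [n] satisfies it if [v] is not reachable from [u]. *)
Definition is_dist (V : finType) (e : rel V) (u v : V) (n : nat) : Prop :=
  (exists p : seq V, [/\ path e u p, last u p = v & size p = n]) /\
  (forall p : seq V, path e u p -> last u p = v -> n <= size p).

Definition is_s_arc (V : finType) (e : rel V) (s : nat)
    (w : s.+1.-tuple V) : Prop :=
  sorted e w.

Definition is_s_geodesic (V : finType) (e : rel V) (s : nat)
    (w : s.+1.-tuple V) : Prop :=
  is_s_arc e w /\ is_dist e (tnth w ord0) (tnth w ord_max) s.

(* Not phrased with [transitive G, on _ | _], which would in addition require
   the set of i-geodesics to be nonempty for each i <= s. *)
Definition geodesic_transitive (V : finType) (e : rel V) (G : {set {perm V}})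
    (s : nat) : Prop :=
  forall i : nat, i <= s ->
  forall w w' : i.+1.-tuple V, is_s_geodesic e w -> is_s_geodesic e w' ->
  exists2 g : {perm V}, g \in G & map_tuple g w = w'.

Definition acts_regularly (V : finType) (N : {set {perm V}}) : Prop :=
  [transitive N, on [set: V] | 'P] /\ forall v : V, 'C_N[v | 'P] = 1.

(* [ordS i] is i + 1 modulo r. *)
Definition is_circuit (V : finType) (e : rel V) : Prop :=
  exists (r : nat) (w : 'I_r -> V),
    [/\ 3 <= r, bijective w & forall i j, e (w i) (w j) = (j == ordS i)].

Definition cayley (gT : finGroupType) (S : {set gT}) : rel gT :=
  [rel h k | [exists x in S, k == x * h]].

Definition cayley_set (gT : finGroupType) (S : {set gT}) : Prop :=
  1 \notin S /\ S :&: S^-1 = set0.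

Lemma cayley_is_digraph (gT : finGroupType) (S : {set gT}) :
  cayley_set S -> is_digraph (cayley S).
Proof.
case=> S1 SV; split=> [h | h k] /=.
  apply/negbTE/negP => /exists_inP [x xS /eqP]; rewrite -{1}[h]mul1g => /mulIg x1.
  by rewrite -x1 (negPf S1) in xS.
case/andP=> /exists_inP H1 /exists_inP H2.
case: H1 H2 => x xS /eqP-> [y yS /eqP].
rewrite mulgA -{1}[h]mul1g => /mulIg/esym yx.
have: x \in S :&: S^-1.
  rewrite inE xS inE; suff <-: y = x^-1 by [].
  by apply/(mulIg x); rewrite yx mulVg.
by rewrite SV inE.
Qed.

(* The group gT acting on itself by right multiplication. *)
Definition right_regular (gT : finGroupType) : {group {perm gT}} :=
  [group of actperm 'R @* [set: gT]].

Definition normal_cayley (gT : finGroupType) (S : {set gT})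
    (G : {set {perm gT}}) : Prop :=
  G \subset digraph_aut (cayley S) /\ right_regular gT <| G.

(* Main.v *)
Require Import Defs.
From mathcomp Require Import all_boot all_fingroup.
From mathcomp Require Import cyclic zify.

Set Implicit Arguments.
Unset Strict Implicit.
Unset Printing Implicit Defensive.

Local Open Scope group_scope.

(** Identify the vertices with N, so that the digraph is Cay(N, S) and the
    stabilizer of 1 in G acts on N by conjugation. A 2-geodesic starting at 1 is
    a pair (x, y) of elements of S with y x outside S, and all such pairs are
    conjugate. For x in S let a >= 1 be least with x^(a+1) outside S: then
    (x, x^a) is such a pair, so every such pair has the form (z, z^a). If a = 1
    for some x, then distinct x, y in S satisfy y x^k in S for all k, so both
    y x^-1 and its inverse x y^-1 lie in S, which is absurd; hence S is a
    singleton. Otherwise S is closed under squaring; this makes a even and puts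
    x^(a+2) in S, and from there all the powers of x up to x^-1, which is absurd
    as well. *)

(** * Connection sets whose geodesic pairs are all conjugate *)

Section ConnectionSet.

Variables (gT : finGroupType) (S : {set gT}).
Hypotheses (S1 : 1 \notin S) (SV : forall x, x \in S -> x^-1 \notin S).
Hypothesis conjS : forall x y x' y', x \in S -> y \in S -> x' \in S -> y' \in S ->
  y * x \notin S -> y' * x' \notin S -> exists g, x ^ g = x' /\ y ^ g = y'.

(** Otherwise some conjugation takes [(x, x ^+ a)] to [(z, y)]; it commutes with powers, so
    [y = z ^+ a]. *)
Lemma geodesic_pair_power x a z y :
    x \in S -> x ^+ a \in S -> x ^+ a.+1 \notin S ->
    z \in S -> y \in S -> y != z ^+ a ->
  y * z \in S.
Proof.
move=> xS xaS xa1S zS yS; apply: contraNT => yzS.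
have [|g [<- <-]] := conjS xS xaS zS yS _ yzS; first by rewrite -expgSr.
by rewrite conjXg.
Qed.

Lemma square_notin_all_eq x y z :
  x \in S -> x ^+ 2 \notin S -> y \in S -> z \in S -> y = z.
Proof.
move=> xS x2S.
have mulS u v : u \in S -> v \in S -> v != u -> v * u \in S.
  by move=> uS vS neq; apply: (@geodesic_pair_power x 1); rewrite ?expg1.
have mulVS u v : u \in S -> v \in S -> v != u -> v * u^-1 \in S.
  move=> uS vS neq.
  (* The inequality is what lets the induction multiply by [u] again; it persists because
     [v * u ^+ k.+1 = u] would put 1 in [S]. *)
  have vukS k : v * u ^+ k \in S /\ v * u ^+ k != u.
    elim: k => [|k [vukS vuk_neq]]; first by rewrite mulg1.
    rewrite expgSr mulgA mulS //; split=> //.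
    by apply: contraNneq S1 => /(canRL (mulgK u)); rewrite mulgV => <-.
  by rewrite invg_expg; have [] := vukS #[u].-1.
move=> yS zS; apply/eqP/idPn => neq.
have /SV := mulVS _ _ zS yS neq.
by rewrite invMg invgK mulVS // eq_sym.
Qed.

Lemma square_closed_eq0 : (forall x, x \in S -> x ^+ 2 \in S) -> S = set0.
Proof.
move=> sqS; apply/setP=> x; rewrite inE; apply/negbTE/negP=> xS.
have exNS : exists n, x ^+ n.+1 \notin S.
  by exists #[x].-1; rewrite prednK // expg_order.
case: (ex_minnP exNS) => a xaNS amin.
have powS k : 0 < k <= a -> x ^+ k \in S.
  case: k => // k /andP[_ ka]; apply/idPn => /amin; lia.
have a_gt1 : 1 < a.
  case: a xaNS {amin powS} => [|[|a]] //; first by rewrite expg1 xS.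
  by rewrite sqS.
have evenS k : 0 < k <= a -> x ^+ k.*2 \in S.
  by move=> /powS/sqS; rewrite -expgM muln2.
(* For odd [a], [x ^+ a.+1] is the square of a lower power of [x], which lies in [S]. *)
have a_even : ~~ odd a.
  apply: contra xaNS => a_odd.
  have -> : a.+1 = (uphalf a).*2 by lia.
  apply: evenS; lia.
have xa2S : x ^+ a.+2 \in S.
  have -> : a.+2 = (a./2.+1).*2 by lia.
  apply: evenS; lia.
have xVNS : x ^+ #[x].-1 \notin S by rewrite -invg_expg SV.
(* Minimality gives [a.+1 <= #[x]]. Equality would make [x ^+ a] equal to [x^-1], and [a.+2 = #[x]]
   would put 1 in [S]. *)
have lt_a : a.+2 < #[x].
  have := amin #[x].-1; rewrite prednK // expg_order => /(_ S1) a_le.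
  have := order_gt0 x => o_gt0.
  have a1 : a <> #[x].-1 by move=> aE; move: xVNS; rewrite -aE powS //; lia.
  have a2 : a.+2 <> #[x].
    by move=> aE; move: xa2S; rewrite aE expg_order (negPf S1).
  lia.
(* Multiplication by [x] leaves [S] only from [x ^+ a], which these exponents have passed and,
   staying below [#[x]], do not meet again. *)
have upS k : a.+2 + k < #[x] -> x ^+ (a.+2 + k) \in S.
  elim: k => [|k IH] lt_k; first by rewrite addn0.
  have xaS : x ^+ a \in S by apply: powS; lia.
  rewrite addnS expgSr; apply: (geodesic_pair_power xS xaS xaNS xS).
    by apply: IH; lia.
  rewrite eq_expg_mod_order !modn_small; lia.
have := upS (#[x].-1 - a.+2); rewrite subnKC; last by lia.
by rewrite (negPf xVNS) => /(_ _); have := order_gt0 x; lia.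
Qed.

Lemma connection_set_eq y z : y \in S -> z \in S -> y = z.
Proof.
move=> yS zS.
have [/forall_inP sqS | ] := boolP [forall x in S, x ^+ 2 \in S].
  by move: yS; rewrite square_closed_eq0 ?inE.
by case/forall_inPn=> x xS x2S; apply: square_notin_all_eq xS x2S yS zS.
Qed.

End ConnectionSet.

(** * Digraphs with a regular normal group of automorphisms *)

Section RegularNormal.

Variables (V : finType) (e : rel V) (G N : {group {perm V}}).
Hypotheses (e_dig : is_digraph e) (e_conn : connected e).
Hypotheses (autG : G \subset digraph_aut e) (nNG : N <| G).
Hypotheses (ntN : N :!=: 1) (regN : acts_regularly N).

Let arcG (g : {perm V}) u v : g \in G -> e (g u) (g v) = e u v.
Proof. by move/(subsetP autG); rewrite inE => /forallP/(_ u)/forallP/(_ v)/eqP. Qed.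

Let NG (n : {perm V}) : n \in N -> n \in G.
Proof. exact/subsetP/normal_sub. Qed.

Let regular_inj v (m n : {perm V}) : m \in N -> n \in N -> m v = n v -> m = n.
Proof.
move=> mN nN mn; apply/eqP; rewrite eq_mulgV1 -in_set1.
have -> : [set 1] = 'C_N[v | 'P] by rewrite regN.2.
by rewrite inE groupM ?groupV //=; apply/astab1P; rewrite /= apermE permM mn permK.
Qed.

Let regular_onto u v : exists2 n : {perm V}, n \in N & v = n u.
Proof. by have [n nN ->] := atransP2 regN.1 (in_setT u) (in_setT v); exists n. Qed.

(** Identifying [n] in [N] with the vertex [n v] turns [e] into the Cayley digraph of [N] on this
    set. *)
Definition connection_set v := [set n in N | e v ((n : {perm V}) v)].

Lemma arc_connection_set v (m n : {perm V}) : m \in N -> n \in N ->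
  e (m v) (n v) = (n * m^-1 \in connection_set v).
Proof.
move=> mN nN; rewrite inE groupM ?groupV //= permM.
by rewrite -(arcG v (m^-1 (n v)) (NG mN)) permKV.
Qed.

Lemma connection_set1 v : 1 \notin connection_set v.
Proof. by rewrite inE perm1 e_dig.1 andbF. Qed.

Lemma connection_setV v x : x \in connection_set v -> x^-1 \notin connection_set v.
Proof.
move=> xS; have [xN vx] : x \in N /\ e v (x v) by apply/andP; rewrite inE in xS.
apply: contraL (xS) => xVS; have : e (x v) v.
  by rewrite -{2}[v]perm1 arc_connection_set ?mul1g.
move=> xv; have /= xvE := e_dig.2 v (x v); rewrite vx xv in xvE.
by have := connection_set1 v; rewrite inE group1 perm1 {2}xvE // vx.
Qed.

Lemma is_2_geodesic v x y :
    x \in connection_set v -> y \in connection_set v ->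
    y * x \notin connection_set v ->
  is_s_geodesic e [tuple v; x v; (y * x) v].
Proof.
move=> xS yS yxS; have [xN vx] : x \in N /\ e v (x v) by apply/andP; rewrite inE in xS.
have yN : y \in N by move: yS; rewrite inE => /andP[].
have xyx : e (x v) ((y * x) v) by rewrite arc_connection_set ?groupM // mulgK.
split; first by rewrite /is_s_arc /= vx xyx.
rewrite !(tnth_nth v) /=; split.
  by exists [:: x v; (y * x) v]; split=> //=; rewrite vx xyx.
(* A path of length 0 forces [y = x^-1]; one of length 1 forces [y * x] into the connection set. *)
case=> [|u [|u' p]] //= => [_ vE|/andP[vu _] uE].
  have yx1 : y * x = 1.
    by apply: (@regular_inj v); rewrite ?groupM // -vE perm1.
  have yE : y = x^-1 by rewrite -[y](mulgK x) yx1 mul1g.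
  by have := connection_setV xS; rewrite -yE yS.
by move: yxS; rewrite inE groupM //= -uE vu.
Qed.

(** An element [g] of [G] matching the two 2-geodesics fixes [v], so it sends [n v] to [(n ^ g) v];
    by regularity, its action on vertices is conjugation on [N]. *)
Lemma connection_set_conj s v x y x' y' : 2 <= s -> geodesic_transitive e G s ->
    x \in connection_set v -> y \in connection_set v ->
    x' \in connection_set v -> y' \in connection_set v ->
    y * x \notin connection_set v -> y' * x' \notin connection_set v ->
  exists g, x ^ g = x' /\ y ^ g = y'.
Proof.
move=> s2 geoG xS yS x'S y'S yxS yxS'.
have SN z : z \in connection_set v -> z \in N by rewrite inE => /andP[].
have [g gG /(congr1 val)[gv gx gyx]] :=
  geoG 2 s2 _ _ (is_2_geodesic xS yS yxS) (is_2_geodesic x'S y'S yxS').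
have gJ n : n \in N -> n ^ g \in N by rewrite memJ_norm // (subsetP (normal_norm nNG)).
have conjE (n : {perm V}) : (n ^ g) v = g (n v) by rewrite -{1}gv permJ.
have xg : x ^ g = x' by apply: (@regular_inj v); rewrite ?gJ ?SN // conjE.
exists g; split=> //; apply: (mulIg x'); rewrite -{1}xg -conjMg.
by apply: (@regular_inj v); rewrite ?gJ ?groupM ?SN // conjE.
Qed.

Lemma connected_regular_circuit v :
    {in connection_set v &, forall x y, x = y} -> is_circuit e.
Proof.
move=> eqS.
have arcP u w : e u w -> exists2 m : {perm V}, m \in N & u = m v /\
    exists2 x, x \in connection_set v & w = (x * m) v.
  have [m mN ->] := regular_onto v u; have [n nN ->] := regular_onto v w.
  rewrite arc_connection_set // => xS; exists m => //; split=> //.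
  by exists (n * m^-1); rewrite ?mulgKV.
(* A nontrivial [n] moves [v], so the undirected path from [v] to [n v] has a first edge. *)
have [x xS] : exists x, x \in connection_set v.
  have [n nN n1] := trivgPn _ ntN.
  have: n v != v.
    by apply: contra n1 => /eqP nv; apply/eqP/(@regular_inj v); rewrite ?perm1.
  have /connectP[[|u p] /=] := e_conn v (n v); first by move=> _ ->; rewrite eqxx.
  by case/andP=> /orP[] /arcP[m _ [_ [x xS _]]] _ _ _; exists x.
have xN : x \in N by move: xS; rewrite inE => /andP[].
have xkN k : x ^+ k \in N by rewrite groupX.
have xVS := connection_setV xS.
pose w (i : 'I_#[x]) := (x ^+ i) v.
have winj : injective w.
  move=> i j /(regular_inj (xkN i) (xkN j))/eqP.
  by rewrite eq_expg_ord // => /eqP.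
have onto u : exists k, u = (x ^+ k) v.
  have /connectP[p] := e_conn v u.
  have : exists k, v = (x ^+ k) v by exists 0; rewrite perm1.
  elim: p {1 3 4}v => [|u2 p IH] u1 [k u1E] /=; first by move=> _ ->; exists k.
  case/andP=> e12; apply: IH.
  case/orP: e12 => /arcP[m mN [mE [z zS zE]]]; rewrite (eqS z x) // in zE.
    exists k.+1; rewrite zE expgS.
    by rewrite (regular_inj mN (xkN k) (etrans (esym mE) u1E)).
  (* A backward arc lowers the exponent by one, modulo [#[x]]. *)
  exists (k + #[x].-1); rewrite mE.
  have xmk : x * m = x ^+ k by apply: (@regular_inj v); rewrite ?groupM // -zE.
  have mk : m = x^-1 * x ^+ k by rewrite -xmk mulKg.
  by rewrite mk invg_expg -expgD addnC.
have SE z : (z \in connection_set v) = (z == x).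
  by apply/idP/eqP => [zS|-> //]; apply: eqS.
exists #[x], w; split.
(* Order at most 2 would give [x^-1 = x], an element of the connection set. *)
- rewrite ltnNge; apply: contra xVS => o_le; have: x ^+ 2 = 1.
    apply/eqP; rewrite -order_dvdn; have := order_gt0 x.
    by case: #[x] o_le => [|[|[|]]].
  by move/eqP; rewrite expgS expg1 -eq_invg_mul SE.
- apply: inj_card_bij => //; rewrite card_ord.
  rewrite -[#[x]]card_ord -(card_codom winj); apply/subset_leq_card/subsetP => u _.
  have [k ->] := onto u; apply/codomP.
  exists (Ordinal (ltn_pmod k (order_gt0 x))).
  by rewrite /w /= expg_mod_order.
- move=> i j; rewrite arc_connection_set // SE -(inj_eq (mulIg (x ^+ i))) mulgKV.
  by rewrite -expgS eq_expg_mod_order (modn_small (ltn_ord j)).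
Qed.

Lemma regular_normal_circuit s :
  2 <= s -> geodesic_transitive e G s -> is_circuit e.
Proof.
move=> s2 geoG.
(* Nontriviality of [N] supplies a base vertex. *)
have [n _ n1] := trivgPn _ ntN.
have [v _] : exists v, n v != v.
  apply/existsP; apply: contraNT n1; rewrite negb_exists => /forallP nE.
  by apply/eqP/permP=> v; rewrite perm1; apply/eqP; rewrite -[_ == _]negbK.
apply: (@connected_regular_circuit v) => y z.
apply: connection_set_eq; first exact: connection_set1.
  exact: connection_setV.
by move=> x1 y1 x2 y2; apply: (connection_set_conj s2 geoG).
Qed.

End RegularNormal.

(** * The right regular representation and Cayley digraphs *)

Lemma right_regularP (gT : finGroupType) (p : {perm gT}) :
  reflect (exists g, forall h, p h = h * g) (p \in right_regular gT).
Proof.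
apply: (iffP morphimP) => [[g _ _ ->]|[g pE]].
  by exists g => h; rewrite actpermE.
by exists g; rewrite ?inE //; apply/permP=> h; rewrite actpermE pE.
Qed.

Lemma right_regular_acts_regularly (gT : finGroupType) :
  acts_regularly (right_regular gT).
Proof.
split=> [|v].
  apply/imsetP; exists 1; rewrite ?inE //; apply/setP=> h; rewrite inE; apply/esym.
  apply/orbitP; exists (actperm 'R h); last by rewrite /= apermE actpermE /= mul1g.
  by apply/right_regularP; exists h => k; rewrite actpermE.
apply/trivgP/subsetP=> p /setIP[/right_regularP[g pE] /astab1P /=].
rewrite apermE pE -{2}[v]mulg1 => /mulgI g1; rewrite inE; apply/eqP/permP=> h.
by rewrite pE g1 mulg1 perm1.
Qed.

Lemma right_regular_neq1 (gT : finGroupType) :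
  [set: gT] != 1 -> right_regular gT :!=: 1.
Proof.
case/trivgPn=> g _ g1; apply/trivgPn; exists (actperm 'R g).
  by apply/right_regularP; exists g => h; rewrite actpermE.
apply: contra g1 => /eqP/permP/(_ 1); rewrite actpermE perm1 /= mul1g.
by move->.
Qed.

Theorem theorem1p3 :
  (forall (V : finType) (e : rel V) (G N : {group {perm V}}) (s : nat),
     is_digraph e ->
     connected e ->
     G \subset digraph_aut e ->
     2 <= s ->
     geodesic_transitive e G s ->
     N <| G ->
     N :!=: 1 ->
     acts_regularly N ->
     is_circuit e)
  /\
  (forall (gT : finGroupType) (S : {set gT}) (G : {group {perm gT}}) (s : nat),
     [set: gT] != 1 ->
     cayley_set S ->
     connected (cayley S) ->
     normal_cayley S G ->
     2 <= s ->
     geodesic_transitive (cayley S) G s ->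
     is_circuit (cayley S)).
Proof.
split=> [V e G N s e_dig e_conn autG s2 geoG nNG ntN regN|].
  exact: (regular_normal_circuit e_dig e_conn autG nNG ntN regN s2 geoG).
move=> gT S G s nt cS e_conn [autG nRG] s2 geoG.
apply: (regular_normal_circuit (cayley_is_digraph cS) e_conn autG nRG) s2 geoG.
  exact: right_regular_neq1.
exact: right_regular_acts_regularly.
Qed.
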